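(* Let $\mathfrak g$ be an affine Lie algebra and $\Lambda$ a dominant integral weight. Suppose $\eta$ is a dominant weight in $P(\Lambda)$, and write $\eta=\Lambda-\sum_{i=0}^\ell\gamma_i\alpha_i$. If $\eta$ is maximal, then we have $\gamma_i<a_i$ for some $i\in\{0,\dots,\ell\}$.
   Context: $\mathfrak g$ is the affine Kac--Moody algebra over $\mathbb C$ with $(\ell+1)\times(\ell+1)$ affine Cartan matrix $A=[a_{ij}]_{0\le i,j\le\ell}$ (untwisted or twisted), with Cartan subalgebra $\mathfrak h$ (of dimension $\ell+2$), simple roots $\alpha_0,\dots,\alpha_\ell\in\mathfrak h^*$ and simple coroots $h_0,\dots,h_\ell\in\mathfrak h$, $\langle h_i,\alpha_j\rangle=a_{ij}$. The null root is $\delta=\sum_i a_i\alpha_i$, where $(a_0,\dots,a_\ell)$ are the coprime positive integers with $\sum_j a_{ij}a_j=0$ for all $i$. A weight $\eta\in\mathfrak h^*$ is dominant integral if $\langle h_i,\eta\rangle\in\mathbb Z_{\ge0}$ for all $i$. $P(\Lambda)\subseteq\Lambda-\sum_i\mathbb Z_{\ge0}\alpha_i$ is the set of weights of the irreducible integrable highest-weight module $L(\Lambda)$. A weight $\eta\in P(\Lambda)$ is maximal if $\eta+\delta\notin P(\Lambda)$. *)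

(* Defs.v *)
From HB Require Import structures.
From mathcomp Require Import all_boot all_order all_algebra.
From mathcomp Require Import reals complex.

Set Implicit Arguments.
Unset Strict Implicit.
Unset Printing Implicit Defensive.

Import Order.TTheory GRing.Theory Num.Theory.
Local Open Scope ring_scope.

(* Subspaces, subalgebras, ideals and submodules are given as boolean
   predicates, so that submod_closed applies; with the classical axioms behind
   realType every subset is of this form. *)

Definition generalized_cartan n (A : 'M[int]_n) : Prop :=
  [/\ forall i, A i i = 2,
      forall i j, i != j -> A i j <= 0
    & forall i j, A i j = 0 -> A j i = 0].

Definition indecomposable n (A : 'M[int]_n) : Prop :=
  forall S : {set 'I_n}, S != set0 -> S != [set: 'I_n] ->
    exists i j, [/\ i \in S, j \notin S & A i j != 0].

(* The trichotomy "finite / affine / indefinite" of indecomposable generalized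
   Cartan matrices is phrased with real vectors; this is its affine case, and
   it covers the untwisted and the twisted affine matrices. *)
Definition affine_cartan (R : realType) n (A : 'M[int]_n) : Prop :=
  let AR : 'M[R]_n := map_mx intr A in
  [/\ generalized_cartan A,
      indecomposable A,
      (\rank AR).+1 = n,
      exists u : 'cV[R]_n, (forall i, 0 < u i 0) /\ AR *m u = 0
    & forall v : 'cV[R]_n, (forall i, 0 <= (AR *m v) i 0) -> AR *m v = 0].

Definition null_marks n (A : 'M[int]_n) (a : 'I_n -> nat) : Prop :=
  [/\ forall i, (0 < a i)%N,
      \big[gcdn/0%N]_(i < n) a i = 1%N
    & forall i, \sum_(j < n) A i j * (a j)%:Z = 0].

HB.mixin Record Lmodule_isLie (K : fieldType) g of GRing.Lmodule K g := {
  lie : g -> g -> g;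
  lie_linearl : forall y, linear (lie^~ y);
  lie_linearr : forall x, linear (lie x);
  liexx : forall x, lie x x = 0;
  lie_jacobi : forall x y z,
    lie x (lie y z) + lie y (lie z x) + lie z (lie x y) = 0
}.

#[short(type="lieType")]
HB.structure Definition Lie (K : fieldType) :=
  {g of Lmodule_isLie K g & GRing.Lmodule K g}.

Record realization (K : fieldType) n (A : 'M[int]_n) := Realization {
  cartan : vectType K;
  simple_root : 'I_n -> 'Hom(cartan, K^o);
  simple_coroot : 'I_n -> cartan;
  dim_cartan :
    (\dim {:cartan} + \rank (map_mx intr A : 'M[K]_n) = n.*2)%N;
  free_simple_root : free [tuple simple_root i | i < n];
  free_simple_coroot : free [tuple simple_coroot i | i < n];
  pairing : forall i j, simple_root j (simple_coroot i) = (A i j)%:~R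
}.

(* g is the Kac-Moody algebra g(A): it is generated by e_i, f_i and the Cartan
   subalgebra subject to the Chevalley relations, and the largest ideal meeting
   the Cartan subalgebra trivially has been factored out. These conditions
   determine g up to isomorphism. *)
Record kac_moody (K : fieldType) n (A : 'M[int]_n) (g : lieType K) := KacMoody {
  km_realization :> realization K A;
  cartan_in : {linear cartan km_realization -> g};
  gen_e : 'I_n -> g;
  gen_f : 'I_n -> g;
  cartan_in_inj : injective cartan_in;
  km_hh : forall s t, lie (cartan_in s) (cartan_in t) = 0;
  km_ef : forall i j, lie (gen_e i) (gen_f j) =
    if i == j then cartan_in (simple_coroot km_realization i) else 0;
  km_he : forall t i, lie (cartan_in t) (gen_e i) =
    (simple_root km_realization i t : K) *: gen_e i;
  km_hf : forall t i, lie (cartan_in t) (gen_f i) =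
    - ((simple_root km_realization i t : K) *: gen_f i);
  km_gen : forall S : {pred g}, submod_closed S ->
    {in S &, forall x y, lie x y \in S} ->
    (forall t, cartan_in t \in S) ->
    (forall i, gen_e i \in S) -> (forall i, gen_f i \in S) ->
    forall x, x \in S;
  km_radical : forall I : {pred g}, submod_closed I ->
    (forall x, {in I, forall y, lie x y \in I}) ->
    (forall t, cartan_in t \in I -> t = 0) ->
    {in I, forall x, x = 0}
}.

Record lieModule (K : fieldType) (g : lieType K) := LieModule {
  module_sort :> lmodType K;
  act : g -> module_sort -> module_sort;
  act_linearl : forall v, linear (act^~ v);
  act_linearr : forall x, linear (act x);
  act_lie : forall x y v, act (lie x y) v = act x (act y v) - act y (act x v)
}.

Section Modules.
Variables (K : fieldType) (g : lieType K) (V : lieModule g).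

Definition submodule (W : {pred V}) : Prop :=
  submod_closed W /\ forall x, {in W, forall v, act x v \in W}.

Definition irreducible : Prop :=
  (exists v : V, v != 0) /\
  forall W : {pred V}, submodule W ->
    {in W, forall v, v = 0} \/ (forall v, v \in W).

Variables (n : nat) (A : 'M[int]_n) (D : kac_moody A g).
Implicit Types (mu Lam : 'Hom(cartan D, K^o)) (v : V).

Definition weight_vector mu v : Prop :=
  forall t, act (cartan_in D t) v = (mu t : K) *: v.

Definition is_weight mu : Prop := exists2 v, v != 0 & weight_vector mu v.

Definition highest_weight_module Lam : Prop :=
  exists v, [/\ v != 0,
    weight_vector Lam v,
    forall i, act (gen_e D i) v = 0
  & forall W : {pred V}, submodule W -> v \in W -> forall w, w \in W].

Definition locally_nilpotent (x : g) : Prop :=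
  forall v, exists k, iter k (act x) v = 0.

Definition integrable : Prop :=
  [/\ forall v, exists2 s : seq V,
        {in s, forall w, exists mu, weight_vector mu w} & v = \sum_(w <- s) w,
      forall i, locally_nilpotent (gen_e D i)
    & forall i, locally_nilpotent (gen_f D i)].

(* V is (isomorphic to) L(Lam). *)
Definition is_L Lam : Prop :=
  [/\ irreducible, integrable & highest_weight_module Lam].

End Modules.

Section Weights.
Variables (K : fieldType) (g : lieType K) (n : nat) (A : 'M[int]_n).
Variable D : kac_moody A g.
Implicit Types eta : 'Hom(cartan D, K^o).

Definition dominant_integral eta : Prop :=
  forall i, exists k : nat, eta (simple_coroot D i) = k%:R.

Definition null_root (a : 'I_n -> nat) : 'Hom(cartan D, K^o) :=
  \sum_(i < n) simple_root D i *+ a i.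

Definition maximal_weight (V : lieModule g) (a : 'I_n -> nat) eta : Prop :=
  is_weight V eta /\ ~ is_weight V (eta + null_root a).

End Weights.

(* Main.v *)
(** Suppose [gamma i >= a i] for all [i]. Then [lam := eta + delta] is dominant
    integral and lies below [Lam]. Descend from [Lam] towards [lam] through
    weights [mu = lam + \sum_i u_i alpha_i] with [u >= 0], as long as possible.
    If the descent stops at [mu], then [f_i] kills a [mu]-weight vector for every
    [i] with [u_i > 0], so [mu(h_i) <= 0] by sl_2-theory, hence [(A u)_i <= 0];
    for [u_i = 0] this holds by the signs of [A]. As [A] is affine, [A u = 0],
    and [u] is zero or everywhere positive. In the first case [lam] is a weight,
    against maximality. In the second one [mu(h_i) = 0] for all [i], the weight
    vector is killed by all [e_i] and [f_i], so it spans [V], whence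
    [eta = Lam] and [gamma = 0]. *)
Require Import Defs.
From HB Require Import structures.
From mathcomp Require Import all_boot all_order all_algebra.
From mathcomp Require Import boolp reals complex.
From mathcomp Require Import ring zify.

Set Implicit Arguments.
Unset Strict Implicit.
Unset Printing Implicit Defensive.

Import Order.TTheory GRing.Theory Num.Theory.
Local Open Scope ring_scope.

(** By induction, [f] sends [e^(p+1) v] to [-(p+1)(c+p) e^p v]. At the least [q] with
    [e^(q+1) v = 0] this coefficient must vanish, and characteristic 0 gives [c = -q]. *)
Lemma sl2_lowest_weight (K : numFieldType) (V : lmodType K)
    (e f : {linear V -> V}) (h : V -> V) (c : K) (v : V) :
    (forall w, f (e w) = e (f w) - h w) ->
    (forall w, h (e w) = e (h w) + 2%:R *: e w) ->
    v != 0 -> f v = 0 -> h v = c *: v -> (exists k, iter k e v = 0) ->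
  exists q, c = - q%:R /\ e (iter q e v) = 0.
Proof.
move=> fe he v0 fv hv ex.
have hiter p : h (iter p e v) = (c + p%:R *+ 2) *: iter p e v.
  elim: p => [|p IHp] /=; first by rewrite mul0rn addr0.
  rewrite he IHp linearZ -scalerDl; congr (_ *: _).
  by rewrite -addrA; congr (_ + _); rewrite -[in RHS]natr1; ring.
have fiter p : f (iter p.+1 e v) = - (p.+1%:R * (c + p%:R)) *: iter p e v.
  elim: p => [|p IHp]; first by rewrite /= fe fv linear0 hv add0r mul1r addr0 scaleNr.
  rewrite [iter p.+2 e v]/= fe -/(iter p.+1 e v) IHp linearZ hiter -scaleNr.
  rewrite -scalerDl; congr (_ *: _).
  by rewrite -[p.+2%:R]natr1 -[p.+1%:R]natr1; ring.
have exb : exists k, iter k e v == 0 by case: ex => k /eqP; exists k.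
(* The least exponent killing [v] is not 0 because [v != 0], so it has the form [q.+1]. *)
case: (ex_minnP exb) => -[|q] /eqP eq0 qmin; first by rewrite (eq0 : v = 0) eqxx in v0.
exists q; split=> //.
have eqn0 : iter q e v != 0.
  by apply/negP => /qmin; rewrite ltnn.
have := fiter q; rewrite eq0 linear0 => /esym/eqP.
rewrite scaler_eq0 (negPf eqn0) orbF oppr_eq0 mulf_eq0 pnatr_eq0 /=.
by rewrite addr_eq0 => /eqP.
Qed.

(** The affine condition, applied to [-u], turns a one-sided bound into an equality. *)
Lemma affine_cartan_nonpos (R : realType) n (A : 'M[int]_n) (u : 'I_n -> nat) :
    affine_cartan R A -> (forall i, \sum_j A i j * (u j)%:Z <= 0) ->
  forall i, \sum_j A i j * (u j)%:Z = 0.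
Proof.
move=> [_ _ _ _ hA] Au_le0 i.
pose v : 'cV[R]_n := \col_j - (u j)%:R.
have AvE k : (map_mx intr A *m v) k 0 = - (\sum_j A k j * (u j)%:Z)%:~R :> R.
  rewrite !mxE rmorph_sum -sumrN; apply: eq_bigr => j _.
  by rewrite !mxE rmorphM mulrN.
have := hA v _; move/(_ _)/matrixP/(_ i 0).
rewrite AvE mxE => /(_ _)/eqP; rewrite oppr_eq0 intr_eq0 => H.
by apply/eqP/H => k; rewrite AvE oppr_ge0 lerz0.
Qed.

(** If the zero set [S] of [u] is proper and nonempty, indecomposability links some [i] in [S] to
    some [j] outside. Row [i] of [A u = 0] is then a sum of nonpositive terms, of which the [j]-th
    is nonzero. *)
Lemma affine_cartan_ker (R : realType) n (A : 'M[int]_n) (u : 'I_n -> nat) :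
    affine_cartan R A -> (forall i, \sum_j A i j * (u j)%:Z = 0) ->
  (forall i, u i = 0)%N \/ (forall i, 0 < u i)%N.
Proof.
move=> [[_ offdiag _] indec _ _ _] Au0.
pose S := [set i | u i == 0%N].
have [S0|SN0] := eqVneq S set0.
  right=> i; rewrite lt0n; apply/negP => ui0.
  by have := in_set0 i; rewrite -S0 inE ui0.
have [ST|SNT] := eqVneq S setT.
  by left=> i; apply/eqP; have := in_setT i; rewrite -ST inE.
have [i [j [iS jS Aij]]] := indec S SN0 SNT.
have term_ge0 k : true -> 0 <= - (A i k * (u k)%:Z).
  move=> _; have [->|ki] := eqVneq k i.
    by move: iS; rewrite inE => /eqP ->; rewrite mulr0 oppr0.
  by rewrite oppr_ge0 mulr_le0_ge0 // offdiag // eq_sym.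
have /eqP : \sum_k - (A i k * (u k)%:Z) = 0 by rewrite sumrN Au0 oppr0.
rewrite psumr_eq0 // => /allP/(_ j (mem_index_enum j)) /=.
rewrite oppr_eq0 mulf_eq0 (negPf Aij) /= => uj0.
by move: jS; rewrite inE eqz_nat in uj0 *; rewrite uj0.
Qed.

HB.instance Definition _ (K : fieldType) (g : lieType K) (V : lieModule g) x :=
  GRing.isLinear.Build K V V *:%R (@act K g V x) (@act_linearr K g V x).

Section WeightSpaces.
Variables (K : numFieldType) (g : lieType K) (V : lieModule g).
Variables (n : nat) (A : 'M[int]_n) (D : kac_moody A g).
Implicit Types (mu lam : 'Hom(cartan D, K^o)) (v w : V).

Lemma weight_vector_inj mu lam v :
  v != 0 -> weight_vector mu v -> weight_vector lam v -> mu = lam.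
Proof.
move=> v0 muv lamv; apply/lfunP => t; apply/eqP.
rewrite -subr_eq0; have /eqP := etrans (esym (muv t)) (lamv t).
by rewrite -subr_eq0 -scalerBl scaler_eq0 (negPf v0) orbF.
Qed.

Lemma actZl (c : K) x v : act (c *: x) v = c *: act x v.
Proof.
have L := act_linearl v; have a0 : act 0 v = 0 :> V.
  by have := L (-1) 0 0; rewrite /= scaler0 addr0 scaleN1r addNr.
by have := L c x 0; rewrite /= !addr0 a0 addr0.
Qed.

Lemma actZr (c : K) x v : act x (c *: v) = c *: act x v.
Proof. exact: linearZ. Qed.

Lemma act_gen_f_weight mu v i : weight_vector mu v ->
  weight_vector (mu - simple_root D i) (act (gen_f D i) v).
Proof.
move=> muv t; have := act_lie (cartan_in D t) (gen_f D i) v.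
rewrite km_hf -scaleNr actZl muv actZr => /eqP; rewrite eq_sym subr_eq.
by move=> /eqP ->; rewrite lfunE /= lfunE /= addrC -scalerDl.
Qed.

Lemma pairing_sum_root lam (u : 'I_n -> nat) i :
  (lam + \sum_j simple_root D j *+ u j) (simple_coroot D i) =
    lam (simple_coroot D i) + (\sum_j A i j * (u j)%:Z)%:~R.
Proof.
rewrite lfunE /= sum_lfunE rmorph_sum /=; congr (_ + _).
apply: eq_bigr => j _; rewrite rmorphM /= -(pairing D).
by rewrite -scaler_nat lfunE /= mulrC.
Qed.

(** The same [q] measures both the weight and the length of the [e_i]-string, so that [mu(h_i) = 0]
    will force [e_i v = 0]. *)
Lemma weight_vector_lowest mu v i : A i i = 2 ->
    locally_nilpotent V (gen_e D i) ->
    v != 0 -> weight_vector mu v -> act (gen_f D i) v = 0 ->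
  exists q, mu (simple_coroot D i) = - q%:R /\
    act (gen_e D i) (iter q (act (gen_e D i)) v) = 0.
Proof.
move=> Aii nile v0 muv fv.
apply: (@sl2_lowest_weight _ _ (act (gen_e D i)) (act (gen_f D i))
  (act (cartan_in D (simple_coroot D i)))) => // w.
  have := act_lie (gen_e D i) (gen_f D i) w; rewrite km_ef eqxx => ->.
  by rewrite opprB addrC subrK.
have := act_lie (cartan_in D (simple_coroot D i)) (gen_e D i) w.
by rewrite km_he pairing Aii actZl => ->; rewrite addrC subrK.
Qed.

(** The elements of [g] acting on [v] by a scalar form a subalgebra containing all generators, hence
    everything. The line through [v] is therefore a nonzero submodule. *)
Lemma irreducible_line mu v : irreducible V -> v != 0 -> weight_vector mu v ->
    (forall i, act (gen_e D i) v = 0) -> (forall i, act (gen_f D i) v = 0) ->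
  forall w, exists c, w = c *: v.
Proof.
move=> [_ irr] v0 muv ev fv.
pose S : {pred g} := fun x => `[< exists c, act x v = c *: v >].
pose W : {pred V} := fun w => `[< exists c, w = c *: v >].
have SP x : reflect (exists c, act x v = c *: v) (x \in S) by exact: asboolP.
have WP w : reflect (exists c, w = c *: v) (w \in W) by exact: asboolP.
have allS x : x \in S.
  apply: (km_gen (k := D)) x.
  - split.
      by apply/SP; exists 0; rewrite -(scale0r 0) actZl !scale0r.
    move=> c x y /SP[cx xv] /SP[cy yv]; apply/SP; exists (c * cx + cy).
    by have := act_linearl v c x y; rewrite /= xv yv scalerA -scalerDl.
  (* Scalars commute, so the bracket kills [v]. *)
  - move=> x y /SP[cx xv] /SP[cy yv]; apply/SP; exists 0.
    by rewrite act_lie xv yv !actZr xv yv !scalerA mulrC subrr scale0r.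
  - by move=> t; apply/SP; exists (mu t).
  - by move=> i; apply/SP; exists 0; rewrite ev scale0r.
  - by move=> i; apply/SP; exists 0; rewrite fv scale0r.
have subW : submodule W.
  split; first split.
  - by apply/WP; exists 0; rewrite scale0r.
  - move=> c x y /WP[cx ->] /WP[cy ->]; apply/WP; exists (c * cx + cy).
    by rewrite scalerA -scalerDl.
  - move=> x w /WP[c ->]; have /SP[cx xv] := allS x.
    by apply/WP; exists (c * cx); rewrite actZr xv scalerA.
case: (irr W subW) => [W0|Wall w]; last exact/WP.
have vW : v \in W by apply/WP; exists 1; rewrite scale1r.
by rewrite (W0 v vW) eqxx in v0.
Qed.

Lemma line_weight_unique v : (forall w, exists c, w = c *: v) ->
  forall mu lam, is_weight V mu -> is_weight V lam -> mu = lam.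
Proof.
move=> line mu lam [x x0 mux] [y y0 lamy].
have [[c xE] [d yE]] := (line x, line y).
have c0 : c != 0 by apply: contra_neq x0 => c0; rewrite xE c0 scale0r.
apply: (weight_vector_inj y0) lamy => t.
have -> : y = (d / c) *: x by rewrite xE yE scalerA divfK.
by rewrite actZr mux !scalerA mulrC.
Qed.

(** The second alternative is the case where [V] is a line, recorded only through its having a
    single weight. The induction is on the height [\sum_i u i]. *)
Lemma dominant_below_weight (R : realType) lam (u : 'I_n -> nat) :
    affine_cartan R A -> irreducible V ->
    (forall i, locally_nilpotent V (gen_e D i)) -> dominant_integral lam ->
    is_weight V (lam + \sum_i simple_root D i *+ u i) ->
  is_weight V lam \/ (forall mu nu : 'Hom(cartan D, K^o),
    is_weight V mu -> is_weight V nu -> mu = nu).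
Proof.
move=> aff irr nile dom; have [[A2 Ale0 _] _ _ _ _] := aff.
have [N] := ubnP (\sum_i u i); elim: N => // N IHN in u * => uN wtu.
set mu := (X in is_weight V X) in wtu.
have [[i [ui wti]]|stuck] :=
  pselect (exists i, (0 < u i)%N /\ is_weight V (mu - simple_root D i)).
  (* The truncated subtraction is exact, since [u i] is positive. *)
  apply: (IHN (fun j => u j - (j == i))%N).
    rewrite (bigD1 i) //= in uN; rewrite (bigD1 i) //= eqxx.
    rewrite (eq_bigr u) => [|j /negPf ->]; last by rewrite subn0.
    by move: ui uN; lia.
  suff -> : lam + \sum_j simple_root D j *+ (u j - (j == i)) =
            mu - simple_root D i by [].
  rewrite /mu -addrA; congr (_ + _).
  rewrite (bigD1 i) //= [in RHS](bigD1 i) //= eqxx mulrnBr // mulr1n addrAC.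
  congr (_ + _ - _); apply: eq_bigr => j /negPf ->; by rewrite subn0.
have [v v0 muv] := wtu.
have fv i : (0 < u i)%N -> act (gen_f D i) v = 0.
  move=> ui; apply/eqP/negP => /negP fv0; apply: stuck; exists i; split=> //.
  by exists (act (gen_f D i) v) => //; exact: act_gen_f_weight.
have muE i : mu (simple_coroot D i) =
    lam (simple_coroot D i) + (\sum_j A i j * (u j)%:Z)%:~R.
  exact: pairing_sum_root.
(* Compare [mu(h_i) = -q] with [mu(h_i) = k + (A u)_i], where [k = lam(h_i)] is a natural number by
   dominance. *)
have low i : (0 < u i)%N -> exists q k : nat,
    [/\ lam (simple_coroot D i) = k%:R,
        \sum_j A i j * (u j)%:Z = - (k + q)%:Z
      & act (gen_e D i) (iter q (act (gen_e D i)) v) = 0].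
  move=> ui; have [k lamk] := dom i.
  have [q [muq eq0]] := weight_vector_lowest (A2 i) (nile i) v0 muv (fv i ui).
  exists q, k; split=> //; apply/eqP; rewrite -(@eqr_int K).
  move: muq; rewrite muE lamk => /(canRL (addKr _)) ->.
  by rewrite rmorphN /= -pmulrn natrD opprD.
have Au0 : forall i, \sum_j A i j * (u j)%:Z = 0.
  apply: (affine_cartan_nonpos aff) => i; have [ui0|ui] := posnP (u i).
    (* When [u i = 0] the diagonal term vanishes and the others are nonpositive. *)
    apply: sumr_le0 => j _; have [->|ij] := eqVneq j i.
      by rewrite ui0 mulr0.
    by apply: mulr_le0_ge0 => //; rewrite Ale0 // eq_sym.
  by have [q [k [_ -> _]]] := low i ui; rewrite oppr_le0.
have [u0|upos] := affine_cartan_ker aff Au0.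
  left; move: wtu; rewrite /mu big1 ?addr0 // => i _; by rewrite u0 mulr0n.
right; apply: (@line_weight_unique v).
apply: (irreducible_line irr v0 muv) => i; last exact: fv.
have [q [k [_ Auq eq0]]] := low i (upos i).
(* Here [k + q = 0], so the [e_i]-string through [v] has length one. *)
have q0 : q = 0%N by move: Auq; rewrite Au0; lia.
by rewrite q0 in eq0.
Qed.

End WeightSpaces.

Lemma free_sum_mulrn_eq0 (K : numFieldType) (vT : vectType K) n
    (b : 'I_n -> vT) (c : 'I_n -> nat) :
  free [tuple b i | i < n] -> \sum_i b i *+ c i = 0 -> forall i, c i = 0%N.
Proof.
move=> /freeP freeb sum0 i; apply/eqP; rewrite -(@pnatr_eq0 K); apply/eqP.
apply: (freeb (fun i => (c i)%:R)); rewrite -[RHS]sum0; apply: eq_bigr => j _.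
by rewrite -tnth_nth tnth_mktuple scaler_nat.
Qed.

Theorem proposition3p4 (R : realType) (l : nat) (A : 'M[int]_(l.+1))
    (hA : affine_cartan R A)
    (a : 'I_(l.+1) -> nat) (ha : null_marks A a)
    (g : lieType R[i]) (D : kac_moody A g)
    (Lam : 'Hom(cartan D, R[i]^o)) (hLam : dominant_integral Lam)
    (V : lieModule g) (hV : is_L V Lam)
    (eta : 'Hom(cartan D, R[i]^o))
    (heta : dominant_integral eta) (hP : is_weight V eta)
    (gamma : 'I_(l.+1) -> nat)
    (hgamma : eta = Lam - \sum_(i < l.+1) simple_root D i *+ gamma i)
    (hmax : maximal_weight V a eta) :
  exists i : 'I_(l.+1), (gamma i < a i)%N.
Proof.
apply: contrapT => /forallNP gamma_ge.
have a_le i : (a i <= gamma i)%N by rewrite leqNgt; apply/negP/gamma_ge.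
have [a_gt0 _ Aa0] := ha.
have [irr [_ nile _] [w [w0 wLam _ _]]] := hV.
have wtLam : is_weight V Lam by exists w.
set lam := eta + null_root D a.
have dom : dominant_integral lam.
  (* Adding the null root changes no value on a coroot, as [A a = 0]. *)
  move=> i; have [k etak] := heta i; exists k.
  have -> : lam (simple_coroot D i) = eta (simple_coroot D i) +
      (\sum_j A i j * (a j)%:Z)%:~R by exact: pairing_sum_root.
  by rewrite Aa0 addr0.
(* The natural subtraction is exact by [a_le]; this is where the assumption towards a contradiction
   enters. *)
have LamE : Lam = lam + \sum_i simple_root D i *+ (gamma i - a i).
  rewrite /lam hgamma -!addrA -big_split /=.
  under [X in _ + (_ + X)]eq_bigr => i _ do rewrite -mulrnDr subnKC //.
  by rewrite addNr addr0.
move: (wtLam); rewrite [X in is_weight V X]LamE => wtLam'.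
have [//|uniq] := dominant_below_weight hA irr nile dom wtLam'.
  exact: hmax.2.
(* With a single weight, [Lam = eta], and the simple roots are independent. Then [gamma] vanishes,
   which contradicts [gamma_ge] because the marks are positive. *)
have gamma0 : forall i, gamma i = 0%N.
  apply: (free_sum_mulrn_eq0 (free_simple_root D)).
  move/eqP: hgamma; rewrite -(uniq _ _ wtLam hP) eq_sym subr_eq addrC.
  by rewrite -subr_eq subrr eq_sym => /eqP.
by apply: (gamma_ge ord0); rewrite gamma0.
Qed.
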